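(* Let $d=s_c+s_e+s_3$ with block sizes $s_c,s_e,s_3\ge 0$, let $A_1\in\mathbb{R}^{s_c\times s_c}$, $A_{12}\in\mathbb{R}^{s_c\times s_e}$, $A_2\in\mathbb{R}^{s_e\times s_e}$, $A_{32},\bar A_{32}\in\mathbb{R}^{s_3\times s_e}$, $A_3,\bar A_3\in\mathbb{R}^{s_3\times s_3}$, $B_1\in\mathbb{R}^{s_c\times d_u}$, and set $$A=\begin{bmatrix}A_1&A_{12}&0\\0&A_2&0\\0&A_{32}&A_3\end{bmatrix},\quad \bar A=\begin{bmatrix}A_1&A_{12}&0\\0&A_2&0\\0&\bar A_{32}&\bar A_3\end{bmatrix},\quad B=\begin{bmatrix}B_1\\0\\0\end{bmatrix}.$$ (1) Let $I_{1+}\in\mathbb{R}^{d\times d}$ be a diagonal matrix with $I_{1+}(i,i)=1$ for every coordinate $i$ of the first block and $I_{1+}(i,i)\in\{0,1\}$ for every other coordinate $i$. If $L_1=(A,B,I_d)$ and $L_2=(A,B,I_{1+})$ are stabilizable, then $K^*(L_1)=K^*(L_2)$. (2) If $L_1=(A,B,I_d)$ and $L_2=(\bar A,B,I_d)$ are stabilizable, then $K^*(L_1)=K^*(L_2)$.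
   Context: An LQ system $L=(A,B,Q)$ has state $x_t\in\mathbb{R}^d$, input $u_t\in\mathbb{R}^{d_u}$ and dynamics $x_{t+1}=Ax_t+Bu_t+\xi_t$, where the $\xi_t$ are i.i.d. zero-mean noise vectors. The cost is $\mathbb{E}\big[\sum_{t\ge1}x_t^\top Qx_t+u_t^\top u_t\big]$ (input cost matrix $R=I_{d_u}$), with $Q\succeq0$. The system is stabilizable if there is $K\in\mathbb{R}^{d_u\times d}$ with $\rho(A+BK)<1$, where $\rho$ is the spectral radius. $K^*(L)$ denotes the optimal controller of $L$, i.e. the linear state-feedback gain $K$ such that the policy $u_t=Kx_t$ minimizes the cost. An LQ system whose matrices have the three-block form above is called a partially controllable LQ (PC-LQ).
   Formalization: The total cost is infinite for every gain under nonzero noise, so the formal statement minimizes the long-run average cost over stabilizing gains, assumes a positive definite noise covariance, and states K*(L1)=K*(L2) as equality of the sets of optimal gains. *)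

(* Defs.v *)
From HB Require Import structures.
From mathcomp Require Import all_boot all_order all_algebra.
From mathcomp Require Import complex.
From mathcomp Require Import all_classical all_reals all_analysis.
Set Implicit Arguments. Unset Strict Implicit. Unset Printing Implicit Defensive.
Import Order.TTheory GRing.Theory Num.Theory numFieldNormedType.Exports.
Local Open Scope classical_set_scope.
Local Open Scope ring_scope.

Section LQ.
Variable R : realType.

Definition spec_rad_lt1 (n : nat) (M : 'M[R]_n) : Prop :=
  forall z : R[i],
    root (char_poly (map_mx (fun x : R => (x%:C)%C) M)) z -> `|z| < 1.

Definition stabilizable (d du : nat) (A : 'M[R]_d) (B : 'M[R]_(d, du)) : Prop :=
  exists K : 'M[R]_(du, d), spec_rad_lt1 (A + B *m K).

(* State covariance at time t of the closed loop x_{t+1} = M x_t + xi_t,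
   started at x_0 = 0, with noise covariance Sigma:
   E[x_t x_t^T] = sum_{s<t} M^s Sigma (M^T)^s. *)
Definition state_cov (d : nat) (M Sigma : 'M[R]_d) (t : nat) : 'M[R]_d :=
  \sum_(s < t) (M ^+ s *m Sigma *m (M^T) ^+ s).

(* Expected per-step cost E[x_t^T Q x_t + u_t^T u_t] with u_t = K x_t. *)
Definition step_cost (d du : nat) (A : 'M[R]_d) (B : 'M[R]_(d, du)) (Q : 'M[R]_d)
    (Sigma : 'M[R]_d) (K : 'M[R]_(du, d)) (t : nat) : R :=
  \tr ((Q + K^T *m K) *m state_cov (A + B *m K) Sigma t).

Definition lq_cost (d du : nat) (A : 'M[R]_d) (B : 'M[R]_(d, du)) (Q : 'M[R]_d)
    (Sigma : 'M[R]_d) (K : 'M[R]_(du, d)) : R :=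
  limn (fun T : nat => (T%:R)^-1 * \sum_(1 <= t < T.+1) step_cost A B Q Sigma K t).

Definition optimal_controller (d du : nat) (A : 'M[R]_d) (B : 'M[R]_(d, du))
    (Q : 'M[R]_d) (Sigma : 'M[R]_d) (K : 'M[R]_(du, d)) : Prop :=
  spec_rad_lt1 (A + B *m K) /\
  forall K' : 'M[R]_(du, d), spec_rad_lt1 (A + B *m K') ->
    lq_cost A B Q Sigma K <= lq_cost A B Q Sigma K'.

Definition pos_def (d : nat) (S : 'M[R]_d) : Prop :=
  S^T = S /\ forall v : 'cV[R]_d, v != 0 -> 0 < (v^T *m S *m v) 0 0.

Definition pc_A (sc se s3 : nat) (A1 : 'M[R]_sc) (A12 : 'M[R]_(sc, se))
    (A2 : 'M[R]_se) (A32 : 'M[R]_(s3, se)) (A3 : 'M[R]_s3) : 'M[R]_(sc + se + s3) :=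
  block_mx (block_mx A1 A12 0 A2) 0 (row_mx 0 A32) A3.

Definition pc_B (sc se s3 du : nat) (B1 : 'M[R]_(sc, du)) : 'M[R]_(sc + se + s3, du) :=
  col_mx (col_mx B1 0) 0.

End LQ.

(* Main.v *)
Require Import Defs.
From HB Require Import structures.
From mathcomp Require Import all_boot all_order all_algebra.
From mathcomp Require Import complex.
From mathcomp Require Import all_classical all_reals all_analysis.
From mathcomp Require Import ring lra.
Import Order.TTheory GRing.Theory Num.Theory numFieldNormedType.Exports.
Set Implicit Arguments. Unset Strict Implicit. Unset Printing Implicit Defensive.
Local Open Scope classical_set_scope.
Local Open Scope ring_scope.

(** The stationary covariance S of a stable closed loop x' = M x + xi is the unique
    solution of S = M S M^T + Sigma, and the long-run cost of a gain K is
    tr ((Q + K^T K) S).  The last two blocks of the state form an uncontrolled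
    quotient of the dynamics, so their stationary covariance does not depend on K,
    and changing the cost on them shifts the cost of all gains by the same constant.
    With all cost on the third block removed, the first two blocks y = C x form a
    system of their own: replacing u = K x by its best linear predictor K1 y given y
    never increases the cost, and leaves it unchanged only if K = K1 C.  So the
    optimal gains are K1 C with K1 optimal for y, where A32 and A3 do not occur. *)

(** * Spectral radius below one: geometric decay of powers, quotients, triangular blocks *)

Section Stability.
Variable R : realType.
Implicit Types (n s t : nat) (r : R).

Local Notation toC := (fun x : R => (x%:C)%C).

Lemma norm_Re (z : R[i]) : `|z| = (complex.Re `|z|)%:C%C.
Proof. by rewrite normc_def. Qed.

Lemma uniform_radius (zs : seq R[i]) :
  (forall z, z \in zs -> `|z| < 1) ->
  exists r : R, [/\ 0 <= r, r < 1 & forall z, z \in zs -> `|z| < (r%:C)%C].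
Proof.
elim: zs => [_|z zs IH zs1]; first by exists 0; split.
have [|r [r0 r1 zsr]] := IH; first by move=> w wzs; apply: zs1; rewrite inE wzs orbT.
have := zs1 z (mem_head _ _); rewrite norm_Re -(rmorph1 (real_complex R)) ltcR => z1.
exists (Num.max r ((complex.Re `|z| + 1) / 2)); split.
- by rewrite le_max r0.
- by rewrite gt_max r1; lra.
move=> w; rewrite inE => /predU1P[->|/zsr wr].
  by rewrite norm_Re ltcR lt_max; apply/orP; right; lra.
by apply: (lt_le_trans wr); rewrite lecR le_max lexx.
Qed.

Lemma geometric_shift_bound (u : nat -> R[i]) (z : R[i]) (C r : R) :
  0 <= r -> `|z| < (r%:C)%C ->
  (forall s, `|u s.+1 - z * u s| <= ((C * r ^+ s)%:C)%C) ->
  exists2 C' : R, 0 <= C' & forall s, `|u s| <= ((C' * r ^+ s)%:C)%C.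
Proof.
move=> r0; rewrite norm_Re ltcR; set a := complex.Re `|z| => ar zu.
have a0 : 0 <= a by rewrite -lecR -norm_Re normr_ge0.
(* The first argument covers s = 0. The second gives C + a C' <= C' r, which makes the envelope C'
   r^s stable under the recursion. *)
exists (Num.max (complex.Re `|u 0%N|) (C / (r - a))).
  by rewrite le_max -lecR -norm_Re normr_ge0.
set C' := Num.max _ _; elim=> [|s IH].
  by rewrite expr0 mulr1 norm_Re lecR le_max lexx.
rewrite -[u s.+1](subrK (z * u s)); apply: (le_trans (ler_normD _ _)).
apply: (@le_trans _ _ ((C * r ^+ s + a * (C' * r ^+ s))%:C)%C).
  rewrite rmorphD lerD// normrM [`|z|]norm_Re -/a.
  by rewrite [X in _ <= X]rmorphM ler_pM// lecR.
have : C <= C' * (r - a).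
  by rewrite -ler_pdivrMr ?subr_gt0// le_max lexx orbT.
have rs : 0 <= r ^+ s by rewrite exprn_ge0.
by rewrite lecR exprS => /(ler_wpM2r rs); lra.
Qed.

(** This replaces the Jordan form. Peeling one root z off the annihilating polynomial leaves, for
    the entries of M^s p(M), a first-order recursion with multiplier z and a forcing term bounded by
    induction. Since |z| < r strictly, repeated roots cost no polynomial factor in s. *)
Lemma horner_mx_geometric n (M : 'M[R[i]]_n.+1) (r : R) (zs : seq R[i]) (p : {poly R[i]}) :
  0 <= r -> (forall z, z \in zs -> `|z| < (r%:C)%C) ->
  horner_mx M (p * \prod_(z <- zs) ('X - z%:P)) = 0 ->
  exists C : R, forall s i j,
    `|horner_mx M ('X^s * p) i j| <= ((C * r ^+ s)%:C)%C.
Proof.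
move=> r0; elim: zs p => [|z zs IH] p zsr.
  rewrite big_nil mulr1 => p0; exists 0 => s i j.
  by rewrite rmorphM /= [horner_mx M p]p0 mulr0 mxE normr0 mul0r.
rewrite big_cons mulrA => /IH[|C hC].
  by move=> w wzs; apply: zsr; rewrite inE wzs orbT.
have /choice[f hf] : forall ij : 'I_n.+1 * 'I_n.+1, exists C' : R, 0 <= C' /\
    forall s, `|horner_mx M ('X^s * p) ij.1 ij.2| <= ((C' * r ^+ s)%:C)%C.
  move=> [i j] /=.
  have [||s|C' C'0 hC'] := @geometric_shift_bound
      (fun s => horner_mx M ('X^s * p) i j : R[i]) z C r; rewrite ?mem_head//.
    by apply: zsr; rewrite mem_head.
    have := hC s i j; congr (`|_| <= _).
    have -> : 'X^s * (p * ('X - z%:P)) = 'X^(s.+1) * p - z *: ('X^s * p).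
      by rewrite -mul_polyC exprS; ring.
    by rewrite raddfB /= linearZ /= !mxE.
  by exists C'.
exists (\sum_ij f ij) => s i j; have [_ /(_ s)/=] := hf (i, j).
move=> /le_trans; apply; rewrite lecR ler_wpM2r ?exprn_ge0//.
rewrite (bigD1 (i, j))//= lerDl sumr_ge0// => ij _.
by have [] := hf ij.
Qed.

Lemma spec_rad_lt1_geometric n (M : 'M[R]_n) : spec_rad_lt1 M ->
  exists C r : R, [/\ 0 <= r, r < 1 & forall s i j, `|(M ^+ s) i j| <= C * r ^+ s].
Proof.
case: n M => [|n] M stM; first by exists 0, 0; split => // s [].
set Mc := map_mx toC M.
have [zs Dzs] := closed_field_poly_normal (char_poly Mc).
rewrite (monicP (char_poly_monic Mc)) scale1r in Dzs.
have [|r [r0 r1 zsr]] := @uniform_radius zs.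
  by move=> z zzs; apply: stM; rewrite Dzs root_prod_XsubC.
(* With p = 1 the annihilating product is the characteristic polynomial, by Cayley-Hamilton. *)
have [|C hC] := @horner_mx_geometric n Mc r zs 1 r0 zsr.
  by rewrite mul1r -Dzs Cayley_Hamilton.
exists C, r; split => // s i j; have := hC s i j.
rewrite mulr1 rmorphXn /= horner_mx_X.
rewrite -(rmorphXn (map_mx (real_complex R))) mxE.
by rewrite normc_def /= expr0n addr0 sqrtr_sqr lecR.
Qed.

Lemma spec_rad_lt1_expr_cvg0 n (M : 'M[R]_n) i j : spec_rad_lt1 M ->
  (fun s => (M ^+ s) i j) @ \oo --> (0 : R).
Proof.
move=> /spec_rad_lt1_geometric[C [r [r0 r1 hM]]].
have Cr0 : (fun s => C * r ^+ s) @ \oo --> (0 : R).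
  by apply: cvg_geometric; rewrite ger0_norm.
apply/norm_cvg0P; apply: (squeeze_cvgr _ (cvg_cst _) Cr0).
by near=> s; rewrite normr_ge0 hM.
Unshelve. all: by end_near. Qed.

Lemma spec_rad_lt1_left_eigen n (M : 'M[R]_n) :
  (forall (z : R[i]) (w : 'rV[R[i]]_n), w != 0 ->
     w *m map_mx toC M = z *: w -> `|z| < 1) <-> spec_rad_lt1 M.
Proof.
split=> [stM z|stM z w w0 wM].
  by rewrite -eigenvalue_root_char => /eigenvalueP[w wM w0]; apply: stM wM.
by apply: stM; rewrite -eigenvalue_root_char; apply/eigenvalueP; exists w.
Qed.

(** A left eigenvector w of N pulls back to the left eigenvector w P of M for the same eigenvalue;
    it is nonzero because P has a right inverse. *)
Lemma spec_rad_lt1_quotient m n (P : 'M[R]_(m, n)) (M : 'M[R]_n) (N : 'M[R]_m) :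
  P *m P^T = 1%:M -> P *m M = N *m P -> spec_rad_lt1 M -> spec_rad_lt1 N.
Proof.
move=> PP PM /spec_rad_lt1_left_eigen stM; apply/spec_rad_lt1_left_eigen => z w w0 wN.
apply: (stM z (w *m map_mx toC P)).
  apply: contra_neq w0 => /(congr1 (mulmx^~ (map_mx toC P^T))).
  by rewrite -mulmxA -map_mxM PP map_mx1 mulmx1 mul0mx.
by rewrite -mulmxA -map_mxM PM map_mxM mulmxA wN scalemxAl.
Qed.

Lemma spec_rad_lt1_lblock m n (M : 'M[R]_m) (L : 'M[R]_(n, m)) (N : 'M[R]_n) :
  spec_rad_lt1 (block_mx M 0 L N) <-> spec_rad_lt1 M /\ spec_rad_lt1 N.
Proof.
have cpE : char_poly (map_mx toC (block_mx M 0 L N)) =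
    char_poly (map_mx toC M) * char_poly (map_mx toC N).
  rewrite /char_poly /char_poly_mx map_block_mx map_mx0 scalar_mx_block.
  by rewrite map_block_mx opp_block_mx add_block_mx map_mx0 oppr0 addr0 det_lblock.
split=> [st|[stM stN] z].
  by split=> z rz; apply: st; rewrite cpE rootM rz ?orbT.
by rewrite cpE rootM => /orP[/stM|/stN].
Qed.

End Stability.

(** * Discrete Lyapunov equations, positivity and the Lyapunov stability criterion *)

Section Lyapunov.
Variable R : realType.
Implicit Types (m n p s t : nat).

Definition mx_cvg m n (X : nat -> 'M[R]_(m, n)) (L : 'M[R]_(m, n)) : Prop :=
  forall i j, (fun t => X t i j) @ \oo --> L i j.

Lemma mx_cvg_cst m n (L : 'M[R]_(m, n)) : mx_cvg (fun=> L) L.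
Proof. by move=> i j; apply: cvg_cst. Qed.

Lemma mx_cvg_unique m n (X : nat -> 'M[R]_(m, n)) L L' :
  mx_cvg X L -> mx_cvg X L' -> L = L'.
Proof.
move=> XL XL'; apply/matrixP => i j.
exact: (cvg_unique _ (XL i j) (XL' i j)).
Qed.

Lemma mx_cvgM m n p (X : nat -> 'M[R]_(m, n)) (Y : nat -> 'M[R]_(n, p)) L L' :
  mx_cvg X L -> mx_cvg Y L' -> mx_cvg (fun t => X t *m Y t) (L *m L').
Proof.
move=> XL YL' i j; rewrite mxE; under eq_fun do rewrite mxE.
by apply: cvg_big => [|k _]; [exact: add_continuous | exact: cvgM].
Qed.

Lemma mx_cvgD m n (X Y : nat -> 'M[R]_(m, n)) L L' :
  mx_cvg X L -> mx_cvg Y L' -> mx_cvg (fun t => X t + Y t) (L + L').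
Proof.
by move=> XL YL' i j; rewrite mxE; under eq_fun do rewrite mxE; apply: cvgD.
Qed.

Lemma mxtrace_cvg n (X : nat -> 'M[R]_n) L :
  mx_cvg X L -> (fun t => \tr (X t)) @ \oo --> \tr L.
Proof. by move=> XL; apply: cvg_big => [|k _]; [exact: add_continuous | exact: XL]. Qed.

Lemma trmxX n (M : 'M[R]_n) t : M^T ^+ t = (M ^+ t)^T.
Proof.
elim: t => [|t IH]; first by rewrite !expr0 trmx1.
by rewrite exprS exprSr IH trmx_mul.
Qed.

Lemma state_cov_lyapunov n (M D X : 'M[R]_n) t : X = M *m X *m M^T + D ->
  state_cov M D t = X - M ^+ t *m X *m M^T ^+ t.
Proof.
move=> XE; elim: t => [|t IH].
  by rewrite /state_cov big_ord0 !expr0 mul1mx mulmx1 subrr.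
rewrite /state_cov big_ord_recr /= -/(state_cov M D t) IH.
have -> : M ^+ t.+1 *m X *m M^T ^+ t.+1 = M ^+ t *m (X - D) *m M^T ^+ t.
  rewrite [in X - D]XE addrK exprSr exprS.
  by rewrite -[_ * M]/(_ *m _) -[M^T * _]/(_ *m _) !mulmxA.
by rewrite mulmxBr mulmxBl opprB addrA addrAC.
Qed.

Section Stable.
Variables (n : nat) (M : 'M[R]_n).
Hypothesis stM : spec_rad_lt1 M.

Lemma state_cov_cvg (D X : 'M[R]_n) : X = M *m X *m M^T + D ->
  mx_cvg (state_cov M D) X.
Proof.
move=> XE; have M0 : mx_cvg (fun t => M ^+ t) 0.
  by move=> i j; rewrite mxE; apply: spec_rad_lt1_expr_cvg0.
have MT0 : mx_cvg (fun t => M^T ^+ t) 0.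
  by move=> i j; under eq_fun do rewrite trmxX mxE; have := M0 j i; rewrite !mxE.
have := mx_cvgM (mx_cvgM M0 (@mx_cvg_cst _ _ (- X))) MT0.
rewrite mulmx0 => /(mx_cvgD (@mx_cvg_cst _ _ X)); rewrite addr0.
congr mx_cvg; apply/funext => t; rewrite (state_cov_lyapunov _ XE).
by rewrite mulmxN mulNmx.
Qed.

Lemma lyapunov_unique (D X Y : 'M[R]_n) :
  X = M *m X *m M^T + D -> Y = M *m Y *m M^T + D -> X = Y.
Proof. by move=> /state_cov_cvg XE /state_cov_cvg; apply: mx_cvg_unique XE. Qed.

(** The linear map X - M X M^T on the space of matrices is injective by uniqueness for D = 0, hence
    bijective in finite dimension; no infinite series has to be summed. *)
Lemma lyapunov_solvable (D : 'M[R]_n) : exists X, X = M *m X *m M^T + D.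
Proof.
pose T := 1%:M - lin_mulmx M *m lin_mulmxr M^T : 'M[R]_(n * n).
have TE X : mxvec X *m T = mxvec (X - M *m X *m M^T).
  by rewrite mulmxBr mulmx1 mulmxA !mul_vec_lin /= linearB.
have Tu : T \in unitmx.
  rewrite -row_free_unit; apply: inj_row_free => v.
  rewrite -[v]vec_mxK TE => /eqP; rewrite mxvec_eq0 subr_eq0 => /eqP XE.
  apply/eqP; rewrite mxvec_eq0; apply/eqP.
  by apply: (@lyapunov_unique 0); rewrite ?mulmx0 ?mul0mx addr0.
exists (vec_mx (mxvec D *m invmx T)); set X := vec_mx _.
have : mxvec X *m T = mxvec D by rewrite vec_mxK mulmxKV.
rewrite TE => /(can_inj mxvecK) <-.
by rewrite addrC subrK.
Qed.

Lemma lyapunov_sym (D X : 'M[R]_n) :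
  D^T = D -> X = M *m X *m M^T + D -> X^T = X.
Proof.
move=> DT XE; apply: (lyapunov_unique (D := D)) => //.
by rewrite {1}XE linearD /= !trmx_mul trmxK DT mulmxA.
Qed.

End Stable.

Definition psd n (D : 'M[R]_n) : Prop := forall v : 'cV[R]_n, 0 <= (v^T *m D *m v) 0 0.

Lemma psd_congr m n (F : 'M[R]_(m, n)) (D : 'M[R]_n) : psd D -> psd (F *m D *m F^T).
Proof.
by move=> D0 v; have := D0 (F^T *m v); rewrite trmx_mul trmxK !mulmxA.
Qed.

Lemma psd_mxtrace_ge0 n (D : 'M[R]_n) : psd D -> 0 <= \tr D.
Proof.
move=> D0; apply: sumr_ge0 => i _; have := D0 (delta_mx i 0).
by rewrite trmx_delta -rowE -colE !mxE.
Qed.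

Lemma pos_def_psd n (D : 'M[R]_n) : pos_def D -> psd D.
Proof.
move=> [_ D0] v; have [->|/D0/ltW//] := eqVneq v 0.
by rewrite mulmx0 mxE.
Qed.

Lemma pos_def_psdD n (D E : 'M[R]_n) : pos_def D -> E^T = E -> psd E -> pos_def (E + D).
Proof.
move=> [DT D0] ET E0; split; first by rewrite linearD /= DT ET.
by move=> v v0; rewrite mulmxDr mulmxDl mxE ltr_wpDl ?E0 ?D0.
Qed.

Lemma pos_def_congr m n (P : 'M[R]_(m, n)) (D : 'M[R]_n) :
  P *m P^T = 1%:M -> pos_def D -> pos_def (P *m D *m P^T).
Proof.
move=> PP [DT D0]; split; first by rewrite !trmx_mul trmxK DT mulmxA.
move=> v v0; have := D0 (P^T *m v); rewrite trmx_mul trmxK !mulmxA; apply.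
by apply: contra_neq v0 => /(congr1 (mulmx P)); rewrite mulmxA PP mul1mx mulmx0.
Qed.

(** The diagonal entries of F D F^T are the values of the form D on the rows of F. They are
    nonnegative with sum zero, so definiteness kills every row. *)
Lemma pos_def_mxtrace0 m n (F : 'M[R]_(m, n)) (D : 'M[R]_n) :
  pos_def D -> \tr (F *m D *m F^T) = 0 -> F = 0.
Proof.
move=> /[dup] /pos_def_psd D0 [_ Dp] tr0; apply/row_matrixP => i; rewrite row0.
have /eqP := tr0; rewrite /mxtrace psumr_eq0 => [/allP/(_ i)|k _]; last first.
  have := psd_congr F D0 (delta_mx k 0).
  by rewrite trmx_delta -rowE -colE !mxE.
rewrite mem_index_enum => /(_ isT)/implyP/(_ isT)/eqP Fi0.
apply/eqP; apply: contraT => Fi; have := Dp (row i F)^T.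
rewrite trmx_eq0 => /(_ Fi); rewrite trmxK.
suff -> : (row i F *m D *m (row i F)^T) 0 0 = (F *m D *m F^T) i i.
  by rewrite Fi0 ltxx.
by rewrite tr_row -row_mul -row_mul !mxE; apply: eq_bigr => k _; rewrite !mxE.
Qed.

Lemma lyapunov_psd n (M D X : 'M[R]_n) :
  spec_rad_lt1 M -> psd D -> X = M *m X *m M^T + D -> psd X.
Proof.
move=> stM D0 /(state_cov_cvg stM) SX v.
have SD t : psd (state_cov M D t).
  move=> w; rewrite mulmx_sumr mulmx_suml summxE; apply: sumr_ge0 => s _.
  by have := psd_congr (M ^+ s) D0 w; rewrite trmxX.
have vSv := mx_cvgM (mx_cvgM (@mx_cvg_cst _ _ v^T) SX) (@mx_cvg_cst _ _ v).
apply: (closed_cvg (fun y : R => 0 <= y) _ _ _ (vSv 0 0)); first exact: closed_ge.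
by near=> t; apply: SD.
Unshelve. all: by end_near. Qed.

Lemma lyapunov_pos_def n (M D X : 'M[R]_n) :
  spec_rad_lt1 M -> pos_def D -> X = M *m X *m M^T + D -> pos_def X.
Proof.
move=> stM Dp XE; have Xsym := lyapunov_sym stM Dp.1 XE.
rewrite XE; apply: pos_def_psdD => //.
  by rewrite !trmx_mul trmxK Xsym mulmxA.
exact/psd_congr/(lyapunov_psd stM (pos_def_psd Dp)).
Qed.

(** For a left eigenvector w, the Hermitian form of S at w M is |z|^2 times its value at w, and the
    hypothesis makes it strictly smaller than that value. *)
Lemma lyapunov_spec_rad_lt1 n (M S : 'M[R]_n) :
  pos_def S -> pos_def (S - M *m S *m M^T) -> spec_rad_lt1 M.
Proof.
move=> Sp Dp; apply/spec_rad_lt1_left_eigen => z w w0 wM.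
pose a := map_mx (@complex.Re R) w; pose b := map_mx (@complex.Im R) w.
pose x := complex.Re z; pose y := complex.Im z.
have ReM u (v : R) : complex.Re (u * v%:C%C) = complex.Re u * v.
  by case: u => ? ? /=; rewrite mulr0 subr0.
have ImM u (v : R) : complex.Im (u * v%:C%C) = complex.Im u * v.
  by case: u => ? ? /=; rewrite mulr0 add0r.
have aM : a *m M = x *: a - y *: b.
  apply/rowP => j; have /rowP/(_ j)/(congr1 (@complex.Re R)) := wM.
  rewrite !mxE raddf_sum [in RHS]/= /x /y.
  under eq_bigr do rewrite mxE /= ReM.
  under [in X in _ -> X]eq_bigr do rewrite mxE.
  by move=> ->; case: (z) (w 0 j) => ? ? [].
have bM : b *m M = x *: b + y *: a.
  apply/rowP => j; have /rowP/(_ j)/(congr1 (@complex.Im R)) := wM.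
  rewrite !mxE raddf_sum [in RHS]/= /x /y.
  under eq_bigr do rewrite mxE /= ImM.
  under [in X in _ -> X]eq_bigr do rewrite mxE.
  by move=> ->; case: (z) (w 0 j) => ? ? [].
(* For symmetric D this is the Hermitian form of D at w = a + i b, written over the reals. *)
pose q (D : 'M[R]_n) := (a *m D *m a^T) 0 0 + (b *m D *m b^T) 0 0.
have q_gt0 D : pos_def D -> 0 < q D.
  move=> /[dup] /pos_def_psd D0 [_ D1]; rewrite /q.
  have [a0|a0] := eqVneq a 0.
    have b0 : b != 0.
      apply: contra_neq w0 => b0; apply/rowP => j.
      have /rowP/(_ j) := a0; have /rowP/(_ j) := b0; rewrite !mxE.
      by case: (w 0 j) => ? ? /= -> ->.
    by have := D1 b^T; rewrite trmx_eq0 trmxK a0 !mul0mx [X in _ -> 0 < X + _]mxE add0r; apply.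
  by apply: ltr_wpDr; [have := D0 b^T|have := D1 a^T]; rewrite ?trmx_eq0 trmxK//; apply.
(* By [aM] and [bM], M acts on the pair (a, b) as multiplication by z = x + i y; the cross terms of
   the two quadratic forms cancel. *)
have qM : q (M *m S *m M^T) = (x ^+ 2 + y ^+ 2) * q S.
  have abS : (b *m S *m a^T) 0 0 = (a *m S *m b^T) 0 0.
    by rewrite -[b *m S *m a^T]trmxK mxE !trmx_mul trmxK Sp.1 mulmxA.
  have quad c e : ((c *: a + e *: b) *m S *m (c *: a + e *: b)^T) 0 0 =
      c ^+ 2 * (a *m S *m a^T) 0 0 + 2 * c * e * (a *m S *m b^T) 0 0 +
      e ^+ 2 * (b *m S *m b^T) 0 0.
    rewrite [(_ + _)^T]linearD /= ![(_ *: _)^T]linearZ /= mulmxDl mulmxDl !mulmxDr.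
    rewrite -!scalemxAr -!scalemxAl; move: abS.
    set aa := a *m S *m a^T; set ab := a *m S *m b^T.
    set ba := b *m S *m a^T; set bb := b *m S *m b^T.
    by rewrite !mxE => ->; ring.
  have qE (u : 'rV[R]_n) : u *m (M *m S *m M^T) *m u^T = (u *m M) *m S *m (u *m M)^T.
    by rewrite trmx_mul !mulmxA.
  rewrite /q !qE aM bM -scaleNr [x *: b + _]addrC !quad.
  ring.
have := q_gt0 _ Dp; have := q_gt0 _ Sp.
have -> : q (S - M *m S *m M^T) = q S - q (M *m S *m M^T).
  by rewrite /q !mulmxBr !mulmxBl !mxE; ring.
rewrite qM => qS; rewrite -{1}[q S]mul1r -mulrBl pmulr_lgt0// subr_gt0 => xy1.
rewrite normc_def -/x -/y -(rmorph1 (real_complex R)) ltcR.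
by rewrite -sqrtr1 ltr_sqrt.
Qed.

End Lyapunov.

(** * The long-run cost as a trace against the stationary covariance *)

Section LongRunCost.
Variable R : realType.

Lemma cesaro_from1 (c : nat -> R) (l : R) : c @ \oo --> l ->
  (fun T => T%:R^-1 * \sum_(1 <= t < T.+1) c t) @ \oo --> l.
Proof.
(* The averages start at t = 1, while [cesaro] starts at index 0. Shifting both the sequence and T
   by one aligns them and discards T = 0, where the inverse has its default value 0. *)
rewrite -cvg_shiftS => /cesaro; rewrite -[X in _ -> X]cvg_shiftS.
congr (_ @ \oo --> l); apply/funext => n /=.
by rewrite /series /= [in RHS]big_add1.
Qed.

Lemma lq_costE d du (A : 'M[R]_d) (B : 'M[R]_(d, du)) (Q Sigma S : 'M[R]_d)
    (K : 'M[R]_(du, d)) :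
  spec_rad_lt1 (A + B *m K) ->
  S = (A + B *m K) *m S *m (A + B *m K)^T + Sigma ->
  lq_cost A B Q Sigma K = \tr ((Q + K^T *m K) *m S).
Proof.
move=> stM /(state_cov_cvg stM) covS.
apply/cvg_lim; first exact: Rhausdorff.
exact/cesaro_from1/mxtrace_cvg/(mx_cvgM (@mx_cvg_cst _ _ _ _) covS).
Qed.

Lemma mxtrace_gram m n (F : 'M[R]_(m, n)) (D : 'M[R]_n) :
  \tr (F^T *m F *m D) = \tr (F *m D *m F^T).
Proof. by rewrite -mulmxA mxtrace_mulC. Qed.

Lemma lyapunov_quotient m n (P : 'M[R]_(m, n)) (M D S : 'M[R]_n) (N : 'M[R]_m) :
  P *m M = N *m P -> S = M *m S *m M^T + D ->
  P *m S *m P^T = N *m (P *m S *m P^T) *m N^T + P *m D *m P^T.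
Proof.
move=> PM {1}->; rewrite mulmxDr mulmxDl; congr (_ + _).
by rewrite !mulmxA PM -!mulmxA -!trmx_mul PM trmx_mul.
Qed.

(** * Costs on a quotient that the input does not reach *)

Section UnactuatedQuotient.
Variables (d e du : nat) (A : 'M[R]_d) (B : 'M[R]_(d, du)) (Sigma : 'M[R]_d).
Variables (P : 'M[R]_(e, d)) (N : 'M[R]_e).
Hypotheses (PP : P *m P^T = 1%:M) (PA : P *m A = N *m P) (PB : P *m B = 0).

Lemma unactuated_quotient_closed_loop K : P *m (A + B *m K) = N *m P.
Proof. by rewrite mulmxDr mulmxA PB mul0mx addr0. Qed.

Lemma optimal_controller_unactuated_cost Q D K :
  optimal_controller A B Q Sigma K <->
  optimal_controller A B (Q + P^T *m D *m P) Sigma K.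
Proof.
rewrite /optimal_controller.
suff costB K1 K2 : spec_rad_lt1 (A + B *m K1) -> spec_rad_lt1 (A + B *m K2) ->
    lq_cost A B (Q + P^T *m D *m P) Sigma K1 - lq_cost A B Q Sigma K1 =
    lq_cost A B (Q + P^T *m D *m P) Sigma K2 - lq_cost A B Q Sigma K2.
  have le_sub (x y x' y' : R) : x - y = x' - y' -> (x <= x') = (y <= y') by lra.
  split=> -[stK opt]; (split; first exact: stK) => K' stK'.
    by rewrite (le_sub _ _ _ _ (costB K K' stK stK')) opt.
  by rewrite -(le_sub _ _ _ _ (costB K K' stK stK')) opt.
move=> st1 st2.
have [S1 S1E] := lyapunov_solvable st1 Sigma.
have [S2 S2E] := lyapunov_solvable st2 Sigma.
rewrite !(lq_costE _ st1 S1E) !(lq_costE _ st2 S2E).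
(* The added cost sees the state only through P S P^T, the covariance of the quotient. *)
have costB K0 S : \tr ((Q + P^T *m D *m P + K0^T *m K0) *m S) -
    \tr ((Q + K0^T *m K0) *m S) = \tr (D *m (P *m S *m P^T)).
  rewrite -[Q + _ + _]addrA [_ *m P + _]addrC addrA [X in X *m _]addrC.
  by rewrite mulmxDl mxtraceD addrK -!mulmxA mxtrace_mulC !mulmxA.
rewrite !costB; congr (\tr (D *m _)).
have stN := spec_rad_lt1_quotient PP (unactuated_quotient_closed_loop K1) st1.
(* Both projected covariances solve the Lyapunov equation of N with noise P Sigma P^T, in which no
   gain occurs. *)
apply: (lyapunov_unique stN).
  exact: lyapunov_quotient (unactuated_quotient_closed_loop K1) S1E.
exact: lyapunov_quotient (unactuated_quotient_closed_loop K2) S2E.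
Qed.

End UnactuatedQuotient.

(** * Reduction to a quotient that carries the whole state cost *)

Section QuotientCost.
Variables (d e du : nat) (A : 'M[R]_d) (B : 'M[R]_(d, du)) (Sigma : 'M[R]_d).
Variables (C : 'M[R]_(e, d)) (A' : 'M[R]_e) (B' : 'M[R]_(e, du)).
Variables (p : nat) (G : 'M[R]_(p, e)).
Hypotheses (CC : C *m C^T = 1%:M) (CA : C *m A = A' *m C) (CB : C *m B = B').
Hypothesis Sigma_gt0 : pos_def Sigma.

(** The Gram form G^T G makes the state cost nonnegative against any positive semidefinite
    covariance. *)
Let Q := C^T *m (G^T *m G) *m C.
Let J := lq_cost A B Q Sigma.
Let J' := lq_cost A' B' (G^T *m G) (C *m Sigma *m C^T).

Lemma lq_cost_quotient K1 : spec_rad_lt1 (A + B *m (K1 *m C)) -> J (K1 *m C) = J' K1.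
Proof.
move=> stM; have CM : C *m (A + B *m (K1 *m C)) = (A' + B' *m K1) *m C.
  by rewrite mulmxDr mulmxDl CA -CB !mulmxA.
have [S SE] := lyapunov_solvable stM Sigma.
rewrite /J /J' (lq_costE _ stM SE).
rewrite (lq_costE _ (spec_rad_lt1_quotient CC CM stM) (lyapunov_quotient CM SE)).
rewrite [in RHS]mulmxA [RHS]mxtrace_mulC; congr (\tr _).
by rewrite !mulmxA mulmxDr !mulmxDl /Q trmx_mul !mulmxA.
Qed.

(* The best predictor K1 of u = K x from y = C x under the stationary covariance
   does at least as well as K: the residual (K - K1 C) x is uncorrelated with y,
   so it only adds control cost and noise. *)
Lemma lq_cost_quotient_le K : spec_rad_lt1 (A + B *m K) ->
  exists K1, [/\ spec_rad_lt1 (A' + B' *m K1), J' K1 <= J K &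
                 J K <= J' K1 -> K = K1 *m C].
Proof.
move=> stM; have [S SE] := lyapunov_solvable stM Sigma.
(* Definiteness is used twice: it makes the covariance [S1] of y invertible, and at the end it turns
   a zero residual cost into a zero residual. *)
have S_gt0 := lyapunov_pos_def stM Sigma_gt0 SE.
have [S_sym _] := S_gt0.
pose S1 := C *m S *m C^T; have S1_gt0 : pos_def S1 := pos_def_congr CC S_gt0.
have S1u : S1 \in unitmx.
  rewrite -row_free_unit; apply: inj_row_free => v vS1.
  apply: contraPeq S1_gt0 => v0 [_ /(_ v^T)]; rewrite trmx_eq0 => /(_ v0).
  by rewrite trmxK vS1 mul0mx mxE ltxx.
(* The regression coefficient of u = K x on y = C x: its normal equations are the orthogonality
   relation [ESC]. *)
pose K1 := K *m S *m C^T *m invmx S1; pose E := K - K1 *m C.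
have KE : K = K1 *m C + E by rewrite addrC subrK.
have ESC : E *m S *m C^T = 0.
  rewrite !mulmxBl -[K1 *m C *m S]mulmxA -[K1 *m _ *m C^T]mulmxA -/S1.
  by rewrite mulmxKV// subrr.
have CSE : C *m S *m E^T = 0.
  by apply: trmx_inj; rewrite !trmx_mul trmxK S_sym mulmxA ESC trmx0.
clearbody E; have [M1 M1E] : exists M1 : 'M[R]_e, M1 = A' + B' *m K1 by eexists.
pose F := B' *m E *m S *m (B' *m E)^T.
have CM : C *m (A + B *m K) = M1 *m C + B' *m E.
  by rewrite mulmxDr mulmxA CA CB {1}KE mulmxDr mulmxA addrA -mulmxDl -M1E.
(* Seen from y, the residual input acts as extra noise with covariance [F]; the cross terms vanish
   by [ESC] and [CSE]. *)
have S1E : S1 = M1 *m S1 *m M1^T + (F + C *m Sigma *m C^T).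
  rewrite {1}/S1 {1}SE mulmxDr mulmxDl addrA; congr (_ + _).
  have -> : C *m ((A + B *m K) *m S *m (A + B *m K)^T) *m C^T =
      (M1 *m C + B' *m E) *m S *m (M1 *m C + B' *m E)^T.
    by rewrite -CM trmx_mul !mulmxA.
  rewrite [(_ + _)^T]linearD /= mulmxDl !mulmxDr !mulmxDl -/F.
  have -> : M1 *m C *m S *m (B' *m E)^T = 0.
    by rewrite trmx_mul mulmxA -[M1 *m C *m S]mulmxA -[M1 *m _ *m E^T]mulmxA CSE mulmx0 mul0mx.
  have -> : B' *m E *m S *m (M1 *m C)^T = 0.
    by rewrite trmx_mul mulmxA -[B' *m E *m S]mulmxA -[B' *m _ *m C^T]mulmxA ESC mulmx0 mul0mx.
  by rewrite add0r addr0 /S1 trmx_mul !mulmxA.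
have F_psd : psd F by apply: psd_congr; apply: pos_def_psd.
have Sigma1_gt0 : pos_def (C *m Sigma *m C^T) by apply: pos_def_congr.
(* [K] need not factor through [C], so [M1] is not known to be a quotient of the closed loop. Its
   stability comes from [S1E] instead, with [S1] as Lyapunov matrix. *)
have stM1 : spec_rad_lt1 M1.
  apply: (lyapunov_spec_rad_lt1 S1_gt0); rewrite {1}S1E addrC addKr.
  apply: pos_def_psdD => //.
  by rewrite /F !trmx_mul !trmxK S_sym !mulmxA.
have [S1' S1'E] := lyapunov_solvable stM1 (C *m Sigma *m C^T).
(* The difference solves the Lyapunov equation with right-hand side [F]: dropping the extra noise
   can only shrink the covariance. *)
have dS_psd : psd (S1 - S1').
  apply: (lyapunov_psd stM1 F_psd).
  rewrite {1}S1E {1}S1'E mulmxBr mulmxBl.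
  by rewrite opprD addrACA addrK.
have trQ (D : 'M[R]_e) : \tr ((G^T *m G + K1^T *m K1) *m D) =
    \tr (G *m D *m G^T) + \tr (K1 *m D *m K1^T).
  by rewrite mulmxDl mxtraceD !mxtrace_gram.
have QE : Q = (G *m C)^T *m (G *m C) by rewrite /Q trmx_mul !mulmxA.
have JE : J K = \tr ((G^T *m G + K1^T *m K1) *m S1) + \tr (E *m S *m E^T).
  rewrite trQ /J (lq_costE _ stM SE) QE mulmxDl mxtraceD !mxtrace_gram -addrA.
  congr (_ + _); first by rewrite trmx_mul !mulmxA.
  rewrite -mxtraceD; congr (\tr _).
  rewrite KE [(_ + _)^T]linearD /= mulmxDl !mulmxDr !mulmxDl trmx_mul !mulmxA ESC.
  by rewrite -[K1 *m C *m S]mulmxA -[K1 *m _ *m E^T]mulmxA CSE mulmx0 mul0mx addr0 add0r /S1 !mulmxA.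
have J'E : J' K1 = \tr ((G^T *m G + K1^T *m K1) *m S1').
  by move: stM1 S1'E; rewrite M1E => /lq_costE; apply.
have ESE_ge0 : 0 <= \tr (E *m S *m E^T).
  exact/psd_mxtrace_ge0/psd_congr/pos_def_psd.
have dJ_ge0 : 0 <= \tr ((G^T *m G + K1^T *m K1) *m (S1 - S1')).
  by rewrite trQ addr_ge0//; apply/psd_mxtrace_ge0/psd_congr.
rewrite mulmxBr linearB /= in dJ_ge0.
exists K1; rewrite -M1E; split => //; first by rewrite J'E JE; lra.
(* The excess of J K over J' K1 is a sum of two nonnegative traces, so the residual trace is
   zero. *)
rewrite J'E JE => JJ'; have /(pos_def_mxtrace0 S_gt0) E0 : \tr (E *m S *m E^T) = 0 by lra.
by rewrite KE E0 addr0.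
Qed.

Hypothesis stab_lift : forall K1,
  spec_rad_lt1 (A' + B' *m K1) -> spec_rad_lt1 (A + B *m (K1 *m C)).

(** [stab_lift] makes the lifted predictor K1 C an admissible competitor of K, at the cost of K1 on
    the quotient. An optimal K cannot lose to it, which is the equality case of
    [lq_cost_quotient_le]. *)
Lemma optimal_controller_quotient K :
  optimal_controller A B Q Sigma K <->
  exists2 K1, K = K1 *m C &
    optimal_controller A' B' (G^T *m G) (C *m Sigma *m C^T) K1.
Proof.
split=> [[stK opt]|[K1 -> [stK1 opt]]].
  have [K1 [stK1 _ eqK]] := lq_cost_quotient_le stK.
  have {eqK} KE : K = K1 *m C.
    apply: eqK; rewrite -(lq_cost_quotient (stab_lift stK1)).
    exact: opt (stab_lift stK1).
  exists K1; first exact: KE.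
  split; first exact: stK1.
  move=> K' stK'; rewrite -/(J' _) -/(J' _).
  rewrite -(lq_cost_quotient (stab_lift stK1)) -(lq_cost_quotient (stab_lift stK')) -KE.
  exact: opt (stab_lift stK').
split; first exact: stab_lift.
move=> K' /lq_cost_quotient_le[K1' [stK1' JK1' _]].
rewrite -/(J _) -/(J _) (lq_cost_quotient (stab_lift stK1)).
exact: le_trans (opt _ stK1') JK1'.
Qed.

End QuotientCost.
End LongRunCost.

(** * The three-block system and its two projections *)

Section PartiallyControllable.
Variables (R : realType) (sc se s3 du : nat).
Variables (A1 : 'M[R]_sc) (A12 : 'M[R]_(sc, se)) (A2 : 'M[R]_se).
Variable B1 : 'M[R]_(sc, du).

Definition uncontrolled_proj : 'M[R]_(se + s3, sc + se + s3) :=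
  block_mx (row_mx 0 1%:M) 0 0 1%:M.

Definition endogenous_proj : 'M[R]_(sc + se, sc + se + s3) := row_mx 1%:M 0.

Lemma uncontrolled_proj_orthonormal :
  uncontrolled_proj *m uncontrolled_proj^T = 1%:M.
Proof.
rewrite tr_block_mx tr_row_mx !trmx0 !trmx1 mulmx_block mul_row_col.
by rewrite !(mulmx0, mul0mx, mulmx1, addr0, add0r) -scalar_mx_block.
Qed.

Lemma endogenous_proj_orthonormal : endogenous_proj *m endogenous_proj^T = 1%:M.
Proof. by rewrite tr_row_mx trmx0 trmx1 mul_row_col mulmx0 mulmx1 addr0. Qed.

Variables (A32 : 'M[R]_(s3, se)) (A3 : 'M[R]_s3).
Let A := pc_A A1 A12 A2 A32 A3.
Let B := pc_B se s3 B1.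

Lemma uncontrolled_proj_A :
  uncontrolled_proj *m A = block_mx A2 0 A32 A3 *m uncontrolled_proj.
Proof.
rewrite /A /pc_A /uncontrolled_proj !mulmx_block !mul_mx_row mul_row_block.
by rewrite !(mulmx0, mul0mx, mulmx1, mul1mx, addr0, add0r) row_mx0 addr0.
Qed.

Lemma uncontrolled_proj_B : uncontrolled_proj *m B = 0.
Proof.
rewrite /B /pc_B /uncontrolled_proj mul_block_col mul_row_col.
by rewrite !(mulmx0, mul0mx, addr0) col_mx0.
Qed.

Lemma endogenous_proj_A :
  endogenous_proj *m A = block_mx A1 A12 0 A2 *m endogenous_proj.
Proof.
rewrite /A /pc_A /endogenous_proj mul_row_block [RHS]mul_mx_row.
by rewrite !(mulmx0, mul0mx, mulmx1, mul1mx, addr0).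
Qed.

Lemma endogenous_proj_B : endogenous_proj *m B = col_mx B1 0.
Proof. by rewrite /B /pc_B mul_row_col mul1mx mul0mx addr0. Qed.

(** The last two blocks evolve by a block triangular matrix that no gain alters, and it is a
    quotient of the stable closed loop. *)
Lemma stabilizable_exogenous_stable : stabilizable A B -> spec_rad_lt1 A3.
Proof.
move=> [K stK]; suff /spec_rad_lt1_lblock[] : spec_rad_lt1 (block_mx A2 0 A32 A3) by [].
apply: spec_rad_lt1_quotient uncontrolled_proj_orthonormal _ stK.
exact: unactuated_quotient_closed_loop uncontrolled_proj_A uncontrolled_proj_B K.
Qed.

(** Provides [stab_lift]: a gain that ignores the third block leaves the closed loop block
    triangular, with [A3] in the corner. *)
Lemma endogenous_stable_lift (K1 : 'M[R]_(du, sc + se)) : spec_rad_lt1 A3 ->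
  spec_rad_lt1 (block_mx A1 A12 0 A2 + col_mx B1 0 *m K1) ->
  spec_rad_lt1 (A + B *m (K1 *m endogenous_proj)).
Proof.
move=> stA3 stK1.
suff -> : A + B *m (K1 *m endogenous_proj) =
    block_mx (block_mx A1 A12 0 A2 + col_mx B1 0 *m K1) 0 (row_mx 0 A32) A3.
  exact/spec_rad_lt1_lblock.
rewrite /A /pc_A /B /pc_B /endogenous_proj mul_mx_row mulmx1 mulmx0 mul_col_row.
by rewrite !mulmx0 !mul0mx add_block_mx !addr0.
Qed.

Lemma optimal_controller_diag_cost Sigma (q : 'rV[R]_(sc + se + s3)) K :
  (forall i : 'I_(sc + se + s3), (i < sc)%N -> q 0 i = 1) ->
  optimal_controller A B (diag_mx q) Sigma K <->
  optimal_controller A B 1%:M Sigma K.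
Proof.
move=> q1; pose q2 := rsubmx (lsubmx q); pose q3 := rsubmx q.
have qE : q = row_mx (row_mx (const_mx 1) q2) q3.
  rewrite -[LHS]hsubmxK -[lsubmx q]hsubmxK; congr (row_mx (row_mx _ _) _).
  by apply/rowP => j; rewrite !mxE; apply: q1 => /=; apply: ltn_ord.
(* What [diag_mx q] lacks to be the identity; it lives on the last two blocks since q is 1 on the
   first. *)
pose D := block_mx (1%:M - diag_mx q2) 0 0 (1%:M - diag_mx q3).
suff -> : 1%:M = diag_mx q + uncontrolled_proj^T *m D *m uncontrolled_proj.
  exact: optimal_controller_unactuated_cost uncontrolled_proj_orthonormal
    uncontrolled_proj_A uncontrolled_proj_B _ _ _.
rewrite /uncontrolled_proj tr_block_mx tr_row_mx !trmx0 !trmx1 !mulmx_block.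
rewrite !(mulmx0, mul0mx, mulmx1, mul1mx, addr0, add0r) mul_col_mx mul_col_row.
rewrite !(mulmx0, mul0mx, mulmx1, mul1mx, addr0, add0r).
rewrite qE !diag_mx_row !add_block_mx diag_const_mx !addr0.
by rewrite ![diag_mx _ + _]addrC !subrK -!scalar_mx_block.
Qed.

(** The right-hand side does not mention [A32] or [A3], so two systems differing only there meet in
    it. The cost 1^T 1 is the Gram form with G = 1. *)
Lemma optimal_controller_endogenous Sigma K : pos_def Sigma -> spec_rad_lt1 A3 ->
  optimal_controller A B 1%:M Sigma K <->
  exists2 K1, K = K1 *m endogenous_proj &
    optimal_controller (block_mx A1 A12 0 A2) (col_mx B1 0) (1%:M^T *m 1%:M)
      (endogenous_proj *m Sigma *m endogenous_proj^T) K1.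
Proof.
move=> Sigma_gt0 stA3.
(* Weight 1 on the first two blocks and 0 on the third: the state cost then factors through
   [endogenous_proj]. *)
rewrite -(@optimal_controller_diag_cost _ (row_mx (const_mx 1) 0)); last first.
  move=> i ic; have ice := leq_trans ic (leq_addr se sc).
  have -> : i = lshift s3 (Ordinal ice) by apply: val_inj.
  by rewrite row_mxEl mxE.
have -> : diag_mx (row_mx (const_mx 1) 0) =
    endogenous_proj^T *m (1%:M^T *m 1%:M) *m endogenous_proj.
  rewrite /endogenous_proj tr_row_mx trmx0 !trmx1 !mulmx1 mul_col_row.
  by rewrite diag_mx_row !(mulmx1, mulmx0, mul0mx) diag_const_mx linear0.
have lift K1 := @endogenous_stable_lift K1 stA3.
exact: (optimal_controller_quotient 1%:M endogenous_proj_orthonormal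
  endogenous_proj_A endogenous_proj_B Sigma_gt0 lift K).
Qed.

End PartiallyControllable.

Theorem theorem1 (R : realType) (sc se s3 du : nat)
    (A1 : 'M[R]_sc) (A12 : 'M[R]_(sc, se)) (A2 : 'M[R]_se)
    (A32 A32b : 'M[R]_(s3, se)) (A3 A3b : 'M[R]_s3) (B1 : 'M[R]_(sc, du))
    (Sigma : 'M[R]_(sc + se + s3)) (hSigma : pos_def Sigma) :
  (forall q : 'rV[R]_(sc + se + s3),
     (forall i : 'I_(sc + se + s3), (i < sc)%N -> q 0 i = 1) ->
     (forall i : 'I_(sc + se + s3), q 0 i = 0 \/ q 0 i = 1) ->
     stabilizable (pc_A A1 A12 A2 A32 A3) (pc_B se s3 B1) ->
     stabilizable (pc_A A1 A12 A2 A32 A3) (pc_B se s3 B1) ->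
     forall K : 'M[R]_(du, sc + se + s3),
       optimal_controller (pc_A A1 A12 A2 A32 A3) (pc_B se s3 B1) 1%:M Sigma K <->
       optimal_controller (pc_A A1 A12 A2 A32 A3) (pc_B se s3 B1) (diag_mx q) Sigma K)
  /\
  (stabilizable (pc_A A1 A12 A2 A32 A3) (pc_B se s3 B1) ->
   stabilizable (pc_A A1 A12 A2 A32b A3b) (pc_B se s3 B1) ->
   forall K : 'M[R]_(du, sc + se + s3),
     optimal_controller (pc_A A1 A12 A2 A32 A3) (pc_B se s3 B1) 1%:M Sigma K <->
     optimal_controller (pc_A A1 A12 A2 A32b A3b) (pc_B se s3 B1) 1%:M Sigma K).
Proof.
split=> [q q1 _ _ _ K|st stb K].
  exact: iff_sym (optimal_controller_diag_cost A1 A12 A2 B1 A32 A3 Sigma K q1).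
have stA3 := stabilizable_exogenous_stable st.
have stA3b := stabilizable_exogenous_stable stb.
exact: iff_trans (optimal_controller_endogenous A1 A12 A2 B1 A32 K hSigma stA3)
  (iff_sym (optimal_controller_endogenous A1 A12 A2 B1 A32b K hSigma stA3b)).
Qed.
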